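(* Let $\Gamma$ be a connected graph with infinite set of vertices $\mathcal{V}$ and path metric $d$ on $\mathcal{V}$; write $B(v,r)=\{u\in\mathcal{V}:d(v,u)\le r\}$ and $B(P,1)=\bigcup_{v\in P}B(v,1)$ for $P\subseteq\mathcal{V}$. Assume that there exist a partition $\mathcal{P}$ of $\mathcal{V}$ and $r\in\mathbb{N}$ such that, for every $P\in\mathcal{P}$, the following conditions hold: (i) $P\subseteq B(v,r)$ for some $v\in\mathcal{V}$; (ii) $|\{P'\in\mathcal{P}: P\neq P',\ P'\cap B(P,1)\neq\emptyset\}|\le |P|$ (as cardinals). Then the coarse structure $\mathcal{E}_{\Gamma}$ is $\vee$-decomposable.
   Context: A coarse structure on a set $X$ is a family $\mathcal{E}$ of subsets of $X\times X$ such that: each $\varepsilon\in\mathcal{E}$ contains the diagonal $\Delta_X=\{(x,x):x\in X\}$; if $\varepsilon,\delta\in\mathcal{E}$ then $\varepsilon\circ\delta=\{(x,y):\exists z\,((x,z)\in\varepsilon,(z,y)\in\delta)\}\in\mathcal{E}$ and $\varepsilon^{-1}=\{(y,x):(x,y)\in\varepsilon\}\in\mathcal{E}$; if $\varepsilon\in\mathcal{E}$ and $\Delta_X\subseteq\varepsilon'\subseteq\varepsilon$ then $\varepsilon'\in\mathcal{E}$. Only connected coarse structures on infinite sets are considered: for any $x,y\in X$ there is $\varepsilon\in\mathcal{E}$ with $(x,y)\in\varepsilon$. A subset $\mathcal{E}'\subseteq\mathcal{E}$ is a base of $\mathcal{E}$ if every $\varepsilon\in\mathcal{E}$ is contained in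 some $\varepsilon'\in\mathcal{E}'$. $\mathcal{E}_0\vee\mathcal{E}_1$ is the smallest (by inclusion) coarse structure on $X$ containing both $\mathcal{E}_0$ and $\mathcal{E}_1$. A coarse structure is cellular if it has a base consisting of equivalence relations. A coarse structure $\mathcal{E}$ on $X$ is $\vee$-decomposable if there exist two cellular coarse structures $\mathcal{E}_0,\mathcal{E}_1$ on $X$ with $\mathcal{E}=\mathcal{E}_0\vee\mathcal{E}_1$. For a metric $d$ on $X$, $\mathcal{E}_d$ is the coarse structure with base $\{(x,y)\in X\times X:d(x,y)\le n\}$, $n\in\omega$. For a connected graph $\Gamma$ with vertex set $\mathcal{V}$ and path metric $d$ on $\mathcal{V}$, $\mathcal{E}_\Gamma$ denotes the coarse structure $\mathcal{E}_d$ on $\mathcal{V}$. *)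

(* Defs.v *)
From mathcomp Require Import all_boot.
From mathcomp Require Import boolp classical_sets functions cardinality.

Set Implicit Arguments.
Unset Strict Implicit.
Unset Printing Implicit Defensive.

Local Open Scope classical_set_scope.
Local Open Scope relation_scope.

(* Entourages are sets of pairs.  Beware that in relation_scope "B \; A" is
   {(x, y) | exists z, (x, z) in A and (z, y) in B}; hence the composition of
   eps and del, with eps followed first, is written "del \; eps". *)

(* Connectedness is part of the definition, so that it is also required of
   E0 and E1 in [decomposable], and of the competitors in [coarse_join]. *)
Definition coarse_structure (X : Type) (E : set (set (X * X))) : Prop :=
  [/\ forall eps, E eps -> diagonal `<=` eps,
      forall eps del, E eps -> E del -> E (del \; eps),
      forall eps, E eps -> E (eps^-1),
      forall eps eps', E eps -> diagonal `<=` eps' -> eps' `<=` eps -> E eps'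
    & forall x y, exists2 eps, E eps & eps (x, y)].

Definition coarse_base (X : Type) (E B : set (set (X * X))) : Prop :=
  B `<=` E /\ forall eps, E eps -> exists2 b, B b & eps `<=` b.

Definition cellular (X : Type) (E : set (set (X * X))) : Prop :=
  exists2 B, coarse_base E B
    & forall b, B b -> RelationClasses.Equivalence (fun x y => b (x, y)).

Definition coarse_join (X : Type) (E0 E1 : set (set (X * X))) :
    set (set (X * X)) :=
  smallest (@coarse_structure X) (E0 `|` E1).

Definition decomposable (X : Type) (E : set (set (X * X))) : Prop :=
  exists E0 E1 : set (set (X * X)),
    [/\ coarse_structure E0, coarse_structure E1, cellular E0, cellular E1
      & E = coarse_join E0 E1].

Definition coarse_of_base (X : Type) (B : set (set (X * X))) :
    set (set (X * X)) :=
  [set eps | diagonal `<=` eps /\ exists2 b, B b & eps `<=` b].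

Definition metric_coarse (X : Type) (d : X -> X -> nat) : set (set (X * X)) :=
  coarse_of_base (range (fun n : nat => [set xy : X * X | d xy.1 xy.2 <= n])).

Section Graph.
Variables (V : Type) (e : rel V).

Definition graph_walk (u v : V) (n : nat) : Prop :=
  exists p : seq V, [/\ path e u p, last u p = v & size p = n].

Definition graph_connected : Prop := forall u v, exists n, graph_walk u v n.

(* The least length of a walk from u to v; the value is 0, by convention,
   when there is no such walk. *)
Definition graph_dist (u v : V) : nat :=
  if pselect (exists n, `[< graph_walk u v n >]) is left h then ex_minn h
  else 0.

Definition graph_ball (v : V) (r : nat) : set V :=
  [set u | graph_dist v u <= r].

Definition graph_nbhd (P : set V) : set V := \bigcup_(v in P) graph_ball v 1.

Definition graph_coarse : set (set (V * V)) := metric_coarse graph_dist.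

End Graph.

(* Main.v *)
(* Each block P injects its set of neighbouring blocks into itself, say by
   P' |-> f P P' in P.  By injectivity, the pairs {f P P', f P' P} taken over
   adjacent blocks P <> P' are pairwise disjoint, hence are the nontrivial
   classes of an equivalence relation M.  An edge of the graph joining P to P'
   decomposes as x ~ f P P' M f P' P ~ y, where ~ is "same block".  Both ~ and M
   are controlled by the path metric.  Since the two cellular structures have to
   be connected, ~ and M are enlarged by merging all the classes which meet a
   ball of growing radius around a fixed vertex. *)
Require Import Defs.
From mathcomp Require Import all_boot.
From mathcomp Require Import boolp classical_sets functions cardinality.

Local Open Scope classical_set_scope.
Local Open Scope card_scope.
Local Open Scope relation_scope.

Import RelationClasses.

(** * Coarse structures generated by a base *)

Lemma coarse_of_base_structure (X : Type) (B : set (set (X * X))) :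
  (forall b, B b -> diagonal `<=` b) ->
  (forall b c, B b -> B c -> exists2 a, B a & c \; b `<=` a) ->
  (forall b, B b -> exists2 a, B a & b^-1 `<=` a) ->
  (forall x y, exists2 b, B b & b (x, y)) ->
  coarse_structure (coarse_of_base B).
Proof.
move=> Bdiag Bcomp Binv Bconn; split.
- by move=> eps [].
- move=> eps del [deps [b Bb epsb]] [ddel [c Bc delc]]; split.
    by move=> [x y] xy; exists x; [exact: deps | exact: ddel].
  have [a Ba ba] := Bcomp _ _ Bb Bc; exists a => //.
  by apply: subset_trans ba => -[x y] [z xz zy]; exists z;
    [exact: epsb | exact: delc].
- move=> eps [deps [b Bb epsb]]; split.
    by move=> [x y] /= xy; apply: deps.
  have [a Ba ba] := Binv _ Bb; exists a => //.
  by apply: subset_trans ba => -[x y]; apply: epsb.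
- move=> eps eps' [_ [b Bb epsb]] deps' eps'eps; split => //.
  by exists b => //; exact: subset_trans epsb.
- move=> x y; have [b Bb bxy] := Bconn x y.
  by exists b => //; split; [exact: Bdiag | exists b].
Qed.

Lemma sub_coarse_of_base (X : Type) (B : set (set (X * X))) :
  (forall b, B b -> diagonal `<=` b) -> B `<=` coarse_of_base B.
Proof. by move=> Bdiag b Bb; split; [exact: Bdiag | exists b]. Qed.

(** * Connected cellular structures obtained by merging classes *)

Section Merge.
Variables (X : Type) (R : X -> X -> Prop).
Hypothesis R_eqv : Equivalence R.

Definition saturation (A : set X) : set X := [set x | exists2 a, A a & R x a].

(** This is the equivalence relation generated by [R] and the square of [A]. *)
Definition merge_classes (A : set X) : set (X * X) :=
  [set xy | R xy.1 xy.2 \/ saturation A xy.1 /\ saturation A xy.2].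

Lemma saturation_closed A x y : R x y -> saturation A y -> saturation A x.
Proof.
by move=> xy [a Aa ya]; exists a => //; exact: Equivalence_Transitive xy ya.
Qed.

Lemma merge_classes_equivalence A :
  Equivalence (fun x y => merge_classes A (x, y)).
Proof.
split.
- by move=> x; left; exact: Equivalence_Reflexive.
- move=> x y [/= xy|[/= ? ?]]; last by right.
  by left; exact: Equivalence_Symmetric.
- move=> x y z [/= xy|[/= sx sy]] [/= yz|[/= sy' sz]].
  + by left; exact: Equivalence_Transitive xy yz.
  + by right; split => //; exact: saturation_closed xy _.
  + right; split => //; apply: saturation_closed sy.
    exact: Equivalence_Symmetric.
  + by right.
Qed.

Lemma merge_classes_mono A A' :
  A `<=` A' -> merge_classes A `<=` merge_classes A'.
Proof.
move=> AA' [x y] [xy|[[a /AA' ? ?] [b /AA' ? ?]]]; first by left.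
by right; split; [exists a | exists b].
Qed.

Lemma diagonal_merge_classes A : diagonal `<=` merge_classes A.
Proof.
by move=> [x y] /diagonalP ->; left; exact: Equivalence_Reflexive.
Qed.

Variable A : nat -> set X.
Hypothesis A_mono : forall m n, m <= n -> A m `<=` A n.
Hypothesis A_cover : forall x, exists n, A n x.

Definition merge_coarse : set (set (X * X)) :=
  coarse_of_base (range (fun n => merge_classes (A n))).

(** Two base relations both lie in the one of larger index; since that one is transitive, it
    contains their composition. Connectedness holds because any two points lie in a common [A n],
    hence in one merged class. *)
Lemma merge_coarse_structure : coarse_structure merge_coarse.
Proof.
apply: coarse_of_base_structure.
- by move=> _ [n _ <-]; exact: diagonal_merge_classes.
- move=> _ _ [m _ <-] [n _ <-]; exists (merge_classes (A (maxn m n))).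
    by exists (maxn m n).
  move=> [x z] [y /= xy yz].
  apply: (@Equivalence_Transitive _ _ (merge_classes_equivalence _) _ y).
    by apply: merge_classes_mono xy; apply: A_mono; exact: leq_maxl.
  by apply: merge_classes_mono yz; apply: A_mono; exact: leq_maxr.
- move=> _ [n _ <-]; exists (merge_classes (A n)); first by exists n.
  move=> [x y].
  exact: (@Equivalence_Symmetric _ _ (merge_classes_equivalence _)).
- move=> x y; have [m Ax] := A_cover x; have [n Ay] := A_cover y.
  exists (merge_classes (A (maxn m n))); first by exists (maxn m n).
  right; split; [exists x | exists y]; try exact: Equivalence_Reflexive.
    by apply: A_mono Ax; exact: leq_maxl.
  by apply: A_mono Ay; exact: leq_maxr.
Qed.

Lemma merge_coarse_cellular : cellular merge_coarse.
Proof.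
exists (range (fun n => merge_classes (A n))); last first.
  by move=> _ [n _ <-]; exact: merge_classes_equivalence.
split; last by move=> eps [].
by apply: sub_coarse_of_base => _ [n _ <-]; exact: diagonal_merge_classes.
Qed.

Lemma merge_coarse_rel : merge_coarse [set xy | R xy.1 xy.2].
Proof.
split; first by move=> [x y] /diagonalP ->; exact: Equivalence_Reflexive.
by exists (merge_classes (A 0)); [exists 0 | move=> xy; left].
Qed.

End Merge.

(** * The path metric and its coarse structure *)

Section GraphMetric.
Variables (V : Type) (e : rel V).
Hypotheses (e_sym : symmetric e) (e_conn : graph_connected e).

Local Notation d := (graph_dist e).

Lemma graph_dist_walk u v : graph_walk e u v (d u v).
Proof.
rewrite /graph_dist; case: pselect => [h|[]].
  by case: ex_minnP => m /asboolP.
by have [n ?] := e_conn u v; exists n; exact/asboolP.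
Qed.

Lemma graph_dist_le u v n : graph_walk e u v n -> d u v <= n.
Proof.
move=> w; rewrite /graph_dist; case: pselect => // h.
by case: ex_minnP => m _; apply; exact/asboolP.
Qed.

Lemma graph_dist_refl u : d u u = 0.
Proof. by apply/eqP; rewrite -leqn0; apply: graph_dist_le; exists [::]. Qed.

Lemma graph_dist_triangle v u w : d u w <= d u v + d v w.
Proof.
have [p [pp lp <-]] := graph_dist_walk u v.
have [q [pq lq <-]] := graph_dist_walk v w.
apply: graph_dist_le; exists (p ++ q).
by rewrite cat_path last_cat lp pp pq size_cat.
Qed.

Lemma graph_dist_sym u v : d u v = d v u.
Proof.
have dle x y : d y x <= d x y.
  have [p [pp lp <-]] := graph_dist_walk x y.
  (* A walk is stored without its starting vertex, so its reversal must drop [y] and keep [x]. *)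
  apply: graph_dist_le; exists (rev (belast x p)); split.
  - by rewrite -lp rev_path (eq_path (e' := e)) // => a b; rewrite e_sym.
  - by case: p {pp} lp => [|a p _] //=; rewrite rev_cons last_rcons.
  - by rewrite size_rev size_belast.
by apply/eqP; rewrite eqn_leq !dle.
Qed.

Lemma graph_coarse_structure : coarse_structure (graph_coarse e).
Proof.
apply: coarse_of_base_structure.
- by move=> _ [n _ <-] [x y] /diagonalP -> /=; rewrite graph_dist_refl.
- move=> _ _ [m _ <-] [n _ <-].
  exists [set xy | d xy.1 xy.2 <= m + n]; first by exists (m + n).
  move=> [x z] [y /= xy yz].
  by apply: leq_trans (graph_dist_triangle y x z) _; exact: leq_add.
- move=> _ [n _ <-]; exists [set xy | d xy.1 xy.2 <= n]; first by exists n.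
  by move=> [x y] /=; rewrite graph_dist_sym.
- move=> x y; exists [set xy | d xy.1 xy.2 <= d x y] => //=.
  by exists (d x y).
Qed.

(** A walk of length [n] is a composition of [n] edges, so the reflexive closure of [e] generates
    the whole structure. The induction on [n] splits off the first edge. *)
Lemma graph_coarse_sub E : coarse_structure E ->
  E [set xy | xy.1 = xy.2 \/ e xy.1 xy.2] -> graph_coarse e `<=` E.
Proof.
move=> [_ Ecomp _ Esub _] Ee.
suff Ed n : E [set xy | d xy.1 xy.2 <= n].
  by move=> eps [deps [_ [n _ <-] epsn]]; exact: Esub (Ed n) deps epsn.
have diag m : diagonal `<=` [set xy : V * V | d xy.1 xy.2 <= m].
  by move=> [x y] /diagonalP -> /=; rewrite graph_dist_refl.
elim: n => [|n IHn].
  apply: Esub Ee (diag 0) _ => -[x y] /= dxy.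
  have [p [pp lp sp]] := graph_dist_walk x y.
  rewrite leqn0 in dxy; rewrite (eqP dxy) in sp.
  by left; rewrite -lp (size0nil sp).
apply: Esub (Ecomp _ _ Ee IHn) (diag _) _ => -[x y] /= dxy.
have [[|a p] [/= pp lp sp]] := graph_dist_walk x y.
  by exists x; [left | rewrite -lp /= graph_dist_refl].
case/andP: pp => xa pp; exists a; first by right.
rewrite -ltnS; apply: leq_trans dxy; rewrite -sp ltnS.
by apply: graph_dist_le; exists p.
Qed.

(** A point whose class meets the ball of radius [n] is within [k + n] of [v0], so the merged class
    has diameter at most twice that. All other classes have diameter at most [k]. *)
Lemma merge_coarse_sub (R : V -> V -> Prop) v0 k : Equivalence R ->
  (forall x y, R x y -> d x y <= k) ->
  merge_coarse _ R (graph_ball e v0) `<=` graph_coarse e.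
Proof.
move=> R_eqv Rk eps [deps [_ [n _ <-] epsn]]; split => //.
exists [set xy | d xy.1 xy.2 <= k + n + (k + n)].
  by exists (k + n + (k + n)).
apply: subset_trans epsn _ => -[x y] /= [/= /Rk xy|].
  by rewrite -addnA; exact: leq_trans xy (leq_addr _ _).
have near z : saturation _ R (graph_ball e v0 n) z -> d z v0 <= k + n.
  move=> [a + /Rk za]; rewrite /graph_ball /= graph_dist_sym => av0.
  by apply: leq_trans (graph_dist_triangle a z v0) _; exact: leq_add.
move=> [/= /near xv0 /near yv0].
apply: leq_trans (graph_dist_triangle v0 x y) _; rewrite leq_add //.
by rewrite graph_dist_sym.
Qed.

End GraphMetric.

(** * Construction of the two cellular structures *)

Lemma card_le_set_inj (T U : Type) (u0 : U) (A : set T) (B : set U) :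
  A #<= B -> exists f : T -> U,
    (forall x, A x -> B (f x)) /\
    (forall x y, A x -> A y -> f x = f y -> x = y).
Proof.
(* [u0] is the default value outside [A], which makes the function total. *)
move=> /card_leP[g]; pose h := valLR u0 g; exists h; split.
  exact: (@funS _ _ _ _ h).
by move=> x y Ax Ay; apply: (@inj _ _ _ h); exact/mem_set.
Qed.

Theorem proposition10 (V : Type) (e : rel V)
  (e_sym : symmetric e) (e_irr : irreflexive e)
  (e_conn : graph_connected e) (V_inf : infinite_set [set: V])
  (PP : set (set V)) (r : nat)
  (PP_part : partition PP (fun P => P) [set: V])
  (PP_bounded : forall P, PP P -> exists v, P `<=` graph_ball e v r)
  (PP_nbrs : forall P, PP P ->
    [set P' | [/\ PP P', P <> P' & P' `&` graph_nbhd e P !=set0]] #<= P) :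
  decomposable (graph_coarse e).
Proof.
have [v0 _] := infinite_setN0 V_inf.
have [PP_cover PP_triv _] := PP_part.
have block_eq P Q x : PP P -> PP Q -> P x -> Q x -> P = Q.
  by move=> ? ? ? ?; apply: PP_triv => //; exists x.
have block_ex x : exists2 P, PP P & P x.
  by have : [set: V] x by []; rewrite -PP_cover => -[P ? ?]; exists P.
pose d := graph_dist e.
have dtri := graph_dist_triangle V e e_conn; rewrite -/d in dtri.
have dsym := graph_dist_sym V e e_sym e_conn; rewrite -/d in dsym.
have block_diam P x y : PP P -> P x -> P y -> d x y <= r + r.
  move=> /PP_bounded[v vP] /vP; rewrite /graph_ball /= -/d dsym => xv /vP vy.
  by apply: leq_trans (dtri v x y) _; exact: leq_add.
pose adj P P' := [/\ PP P', P <> P' & P' `&` graph_nbhd e P !=set0].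
have adj_sym P P' : PP P -> adj P P' -> adj P' P.
  move=> PPP [PPP' PP' [y [P'y [x Px xy]]]]; split => //; first exact: nesym.
  exists x; split => //; exists y => //.
  by move: xy; rewrite /graph_ball /= -/d dsym.
have [f f_inj] : exists f : set V -> set V -> V, forall P, PP P ->
    (forall P', adj P P' -> P (f P P')) /\
    (forall P' P'', adj P P' -> adj P P'' -> f P P' = f P P'' -> P' = P'').
  suff /choice[f fP] : forall P, exists g : set V -> V, PP P ->
      (forall P', adj P P' -> P (g P')) /\
      (forall P' P'', adj P P' -> adj P P'' -> g P' = g P'' -> P' = P'').
    by exists f.
  move=> P; have [PPP|nPPP] := pselect (PP P); last by exists (fun=> v0).
  by have [g gP] := card_le_set_inj _ _ v0 _ _ (PP_nbrs _ PPP); exists g.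
pose R0 x y := exists2 P, PP P & P x /\ P y.
pose M x y := x = y \/
  exists P P', [/\ PP P, adj P P', x = f P P' & y = f P' P].
have R0_eqv : Equivalence R0.
  split.
  - by move=> x; have [P ? ?] := block_ex x; exists P.
  - by move=> x y [P ? [? ?]]; exists P.
  - move=> x y z [P ? [? Py]] [Q ? [Qy ?]].
    by exists P => //; split => //; rewrite (block_eq P Q y).
have M_eqv : Equivalence M.
  split.
  - by move=> x; left.
  - move=> x y [->|[P [P' [PPP PP' -> ->]]]]; first by left.
    by right; exists P', P; split => //; [case: PP' | exact: adj_sym].
  - move=> x y z [->//|[P [P' [PPP PP' xE yE]]]] [<-|].
      by right; exists P, P'.
    (* Two nontrivial steps lead back to [x]: the vertex [y] lies in both [P'] and [Q], so these
       coincide, and injectivity of [f P'] then gives [Q' = P], whence [z = f P P' = x]. *)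
    move=> [Q [Q' [PPQ QQ' yE' zE]]]; left.
    have PPP' : PP P' by case: PP'.
    have P'P := adj_sym _ _ PPP PP'.
    have P'Q : P' = Q.
      apply: (block_eq _ _ y) => //; first by rewrite yE; exact: (f_inj _ _).1.
      by rewrite yE'; exact: (f_inj _ _).1.
    subst Q; have -> : x = f Q' P'; last by [].
    rewrite xE; congr (f _ _).
    by apply: (f_inj _ PPP').2 => //; rewrite -yE.
have R0_bound x y : R0 x y -> d x y <= r + r.
  by move=> [P ? [? ?]]; exact: (block_diam P).
have M_bound x y : M x y -> d x y <= r + r + 1 + (r + r).
  move=> [->|[P [P' [PPP PP' xE yE]]]].
    by rewrite /d graph_dist_refl.
  have P'P := adj_sym _ _ PPP PP'.
  (* The bound follows the route from [x] to [a] inside [P], then to [b] at distance at most 1, then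
     to [y] inside [P']. *)
  have [PPP' _ [b [P'b [a Pa ab]]]] := PP'.
  have xa : d x a <= r + r.
    by apply: (block_diam P) => //; rewrite xE; exact: (f_inj _ _).1.
  have by_ : d b y <= r + r.
    by apply: (block_diam P') => //; rewrite yE; exact: (f_inj _ _).1.
  apply: leq_trans (dtri b x y) _; rewrite leq_add //.
  by apply: leq_trans (dtri a x b) _; rewrite leq_add.
have ball_mono m n : m <= n -> graph_ball e v0 m `<=` graph_ball e v0 n.
  by move=> mn x /= /leq_trans; apply.
have ball_cover x : exists n, graph_ball e v0 n x
  by exists (d v0 x); exact: leqnn.
exists (merge_coarse _ R0 (graph_ball e v0)),
  (merge_coarse _ M (graph_ball e v0)).
split.
- exact: merge_coarse_structure.
- exact: merge_coarse_structure.
- exact: merge_coarse_cellular.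
- exact: merge_coarse_cellular.
(* The join lies in the graph structure by minimality, since both merged structures are controlled
   by [d]. *)
apply/seteqP; split; last first.
  apply: smallest_sub; first exact: graph_coarse_structure.
  rewrite subUset; split.
    exact: merge_coarse_sub R0_bound.
  exact: merge_coarse_sub M_bound.
(* Conversely, let [E] be any coarse structure containing both: it suffices that [E] contains the
   edges together with the diagonal, and these lie in the composition of [R0], [M] and [R0]. *)
move=> eps Eeps E [Ecs E01]; move: eps Eeps; apply: graph_coarse_sub => //.
have ER0 : E [set xy | R0 xy.1 xy.2].
  by apply: E01; left; exact: merge_coarse_rel.
have EM : E [set xy | M xy.1 xy.2].
  by apply: E01; right; exact: merge_coarse_rel.
have [_ Ecomp _ Esub _] := Ecs.
apply: Esub (Ecomp _ _ (Ecomp _ _ ER0 EM) ER0) _ _.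
  by move=> xy; left.
move=> [x y] /= xy.
have [P PPP Px] := block_ex x; have [P' PPP' P'y] := block_ex y.
(* Within one block a single [R0] step suffices, the other two steps staying at [y]; this also
   covers [x = y]. *)
have [PP'|PP'] := pselect (P = P').
  exists y; last by exists P'.
  by exists y; [exists P' => //; rewrite -{1}PP' | left].
have adjPP' : adj P P'.
  split => //; exists y; split => //; exists x => //=.
  case: xy => [->|xy]; first by rewrite /graph_ball /= graph_dist_refl.
  by apply: graph_dist_le; exists [:: y]; rewrite /= xy.
exists (f P' P); last first.
  by exists P' => //=; split => //; apply: (f_inj _ _).1 => //; exact: adj_sym.
exists (f P P'); last by right; exists P, P'.
by exists P => //=; split => //; exact: (f_inj _ _).1.
Qed.
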